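(* Let $\ell>0$ and $\nu(z)=e^{\ell(z+z^{-1})/2}$ on $\mathbb T$ (in which case the coefficients $\alpha_n$ are real). Then for every $n\in\mathbb N$ (the identities for $G_n,G_{n-1}^*$ being for $z\notin\mathbb T$): $$z^2\Phi_n'(z)=\Big\{nz+\frac{\ell}{2}-\frac{\ell}{2}\alpha_{n-1}^2\Big\}\Phi_n(z)+\frac{\ell}{2}b_{n-1}b_n^{-1}(\alpha_{n-1}-\alpha_nz)\Phi_{n-1}^*(z),$$ $$z^2G_n'(z)=\Big\{\frac{\ell}{2}z^2-\frac{\ell}{2}\alpha_{n-1}^2\Big\}G_n(z)+\frac{\ell}{2}b_{n-1}b_n^{-1}(\alpha_{n-1}-\alpha_nz)G_{n-1}^*(z),$$ $$z^2(\Phi_{n-1}^* )'(z)=\frac{\ell}{2}(\alpha_{n-1}-\alpha_{n-2}z)\Phi_n(z)+\Big\{-\frac{\ell}{2}z^2+\frac{\ell}{2}\alpha_{n-1}^2\Big\}\Phi_{n-1}^*(z),$$ $$z^2(G_{n-1}^* )'(z)=\frac{\ell}{2}(\alpha_{n-1}-\alpha_{n-2}z)G_n(z)+\Big\{-nz-\frac{\ell}{2}+\frac{\ell}{2}\alpha_{n-1}^2\Big\}G_{n-1}^*(z).$$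
   Context: $\mathbb N=\{1,2,\dots\}$, $\mathbb T=\{|z|=1\}$ (counterclockwise), $d\mu(z)=\frac{\nu(z)}{\mathrm i z}dz$. $\Phi_n$ is the monic polynomial of degree $n$ with $\int_{\mathbb T}\Phi_n\overline{\Phi_m}\,d\mu=\kappa_n^{-2}\delta_{n,m}$, $\kappa_n>0$; $\Phi_n^*(z)=z^n\overline{\Phi_n(1/\bar z)}$; $\alpha_{n-1}=-\overline{\Phi_n(0)}$ for $n\ge1$ and $\alpha_{-1}=-1$; $b_n=2\pi\kappa_n^2$. For $z\notin\mathbb T$, $$G_n(z)=\frac1{2\pi \mathrm i}\int_{\mathbb T}\frac{\Phi_n(t)}{t-z}\frac{\nu(t)}{t^n}dt,\qquad G_{n-1}^*(z)=\frac1{2\pi \mathrm i}\int_{\mathbb T}\frac{\Phi_{n-1}^*(t)}{t-z}\frac{\nu(t)}{t^n}dt .$$ *)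

(* Defs.v *)
From HB Require Import structures.
From mathcomp Require Import all_boot all_order all_algebra complex.
From mathcomp Require Import all_classical all_reals all_analysis.

Set Implicit Arguments.
Unset Strict Implicit.
Unset Printing Implicit Defensive.

Import Order.TTheory GRing.Theory Num.Theory.
Import numFieldNormedType.Exports.

Local Open Scope ring_scope.
Local Open Scope complex_scope.

Section Contour.
Context {R : realType}.
Local Notation C := R[i].

Definition cexp (z : C) : C :=
  (expR (complex.Re z))%:C * (cos (complex.Im z) +i* sin (complex.Im z)).

Definition cRintegral (a b : R) (f : R -> C) : C :=
  (\int[lebesgue_measure]_(x in `[a, b]%classic) complex.Re (f x))
    +i* (\int[lebesgue_measure]_(x in `[a, b]%classic) complex.Im (f x)).

(* The circle is parametrized counterclockwise by t |-> exp(i t) on [0, 2 pi],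
   so that dz = i exp(i t) dt. *)
Definition circle_integral (f : C -> C) : C :=
  cRintegral 0 (2 * pi)
    (fun t => let z := cexp ('i * t%:C) in f z * ('i * z)).

End Contour.

Section OPUC.
Context {R : realType}.
Local Notation C := R[i].

(* The integral of f with respect to d mu(z) = nu(z) / (i z) dz. *)
Definition mu_integral (nu f : C -> C) : C :=
  circle_integral (fun z => f z * (nu z / ('i * z))).

(* [Phi] and [kappa] are the monic orthogonal polynomials on the unit circle
   for mu, and the leading coefficients of the orthonormal ones. *)
Definition monic_OPUC (nu : C -> C) (Phi : nat -> {poly C}) (kappa : nat -> R) :
    Prop :=
  [/\ forall n, Phi n \is monic,
      forall n, size (Phi n) = n.+1,
      forall n, 0 < kappa n &
      forall n m, mu_integral nu (fun z => (Phi n).[z] * ((Phi m).[z])^*)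
                  = if n == m then ((kappa n) ^- 2)%:C else 0].

(* The polynomial z^n conj(p(1 / conj z)), obtained by conjugating and reversing
   the n + 1 coefficients of p; see [star_polyE]. *)
Definition star_poly (n : nat) (p : {poly C}) : {poly C} :=
  \poly_(i < n.+1) (p`_(n - i))^*.

Lemma star_polyE (n : nat) (p : {poly C}) (z : C) :
  (size p <= n.+1)%N -> z != 0 ->
  (star_poly n p).[z] = z ^+ n * (p.[(z^*)^-1])^*.
Proof.
move=> sp z0; rewrite horner_poly (horner_coef_wide _ sp) rmorph_sum mulr_sumr.
rewrite (reindex_inj rev_ord_inj); apply: eq_bigr => i _ /=.
have le_in : (i <= n)%N by rewrite -ltnS.
rewrite subSS subKn // rmorphM rmorphXn fmorphV /= conjCK mulrCA; congr (_ * _).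
by rewrite exprVn -expfB_cond // (negbTE z0) add0n.
Qed.

(* alpha_k = - conj(Phi_(k+1)(0)) for k >= 0 and alpha_(-1) = -1; indices below
   -1 are irrelevant. *)
Definition verblunsky (Phi : nat -> {poly C}) (k : int) : C :=
  if k is Posz m then - ((Phi m.+1).[0])^* else -1.

Definition bcoef (kappa : nat -> R) (n : nat) : C := (2 * pi * kappa n ^+ 2)%:C.

Definition Gfun (nu : C -> C) (Phi : nat -> {poly C}) (n : nat) (z : C) : C :=
  (2 * pi%:C * 'i)^-1 *
  circle_integral (fun t => (Phi n).[t] / (t - z) * (nu t / t ^+ n)).

(* With index k this is G_k^*, whose denominator is t^(k+1). *)
Definition Gstar (nu : C -> C) (Phi : nat -> {poly C}) (k : nat) (z : C) : C :=
  (2 * pi%:C * 'i)^-1 *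
  circle_integral
    (fun t => (star_poly k (Phi k)).[t] / (t - z) * (nu t / t ^+ k.+1)).

Definition nu_bessel (l : R) (z : C) : C := cexp (l%:C * (z + z^-1) / 2).

End OPUC.

(* Main.v *)
Require Import Defs.
From HB Require Import structures.
From mathcomp Require Import all_boot all_order all_algebra complex.
From mathcomp Require Import ring lra zify.
From mathcomp Require Import all_classical all_reals all_analysis.

Set Implicit Arguments.
Unset Strict Implicit.
Unset Printing Implicit Defensive.

Import Order.TTheory GRing.Theory Num.Theory.
Import numFieldNormedType.Exports.

Local Open Scope ring_scope.
Local Open Scope complex_scope.

(* With <f> the integral of f(exp(i t)) nu(exp(i t)) over [0, 2 pi], everything
   is read off the moments c_k = <z^k>. Integrating the derivative of z^k nu
   over the circle gives the Pearson recursion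
     k c_k + L (c_(k+1) - c_(k-1)) = 0,  L = l / 2,
   which together with c_(-k) = conj(c_k) forces the moments to be real, hence
   Phi_n has real coefficients. In each polynomial identity, the difference of
   the two sides has degree at most n and vanishes at 0, and the Pearson
   recursion shows that it is orthogonal to z, ..., z^n; so it is 0.
   For the Cauchy transforms, differentiating under the integral sign and
   integrating by parts expresses z^2 G' as the transform of
     q = z^2 p' - n z p + L (z^2 - 1) p,
   up to a term in <q z^(-n)>, the term in <q z^(-n-1)> being a total
   derivative. Inserting the polynomial identities in q gives the result. *)

(** * Moments of polynomials against an abstract bi-infinite sequence *)

Section Moments.
Context {R : realType}.
Local Notation C := R[i].
Variable c : int -> C.
Implicit Types (p q : {poly C}) (k : int).

(** With [c j] = <z^j> this is <p z^(-k)>, which on the circle is the inner product of p with z^k.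
    The index is an integer because the arguments below also use k = -1. *)
Definition moment k p : C := \sum_(i < size p) p`_i * c (i%:Z - k).

Lemma moment_wide n k p : (size p <= n)%N ->
  moment k p = \sum_(i < n) p`_i * c (i%:Z - k).
Proof.
move=> sp; rewrite /moment -(subnKC sp) big_split_ord /= [X in _ = _ + X]big1 ?addr0 //.
by move=> i _; rewrite nth_default ?mul0r // leq_addr.
Qed.

Lemma moment_is_linear k : scalar (moment k).
Proof.
move=> a p q; set n := maxn (size p) (size q).
have sp : (size p <= n)%N by rewrite leq_maxl.
have sq : (size q <= n)%N by rewrite leq_maxr.
have spq : (size (a *: p + q)%R <= n)%N.
  by rewrite (leq_trans (size_polyD _ _)) // geq_max sq (leq_trans (size_scale_leq _ _)).
rewrite !(@moment_wide n) // mulr_sumr -big_split; apply: eq_bigr => i _ /=.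
by rewrite coefD coefZ mulrDl mulrA.
Qed.

HB.instance Definition _ k :=
  GRing.isLinear.Build C {poly C} C _ (moment k) (moment_is_linear k).

Lemma momentD k p q : moment k (p + q) = moment k p + moment k q.
Proof. exact: linearD. Qed.

Lemma momentB k p q : moment k (p - q) = moment k p - moment k q.
Proof. exact: linearB. Qed.

Lemma momentZ k a p : moment k (a *: p) = a * moment k p.
Proof. exact: linearZ. Qed.

Lemma momentMX k p : moment k ('X * p) = moment (k - 1) p.
Proof.
rewrite (@moment_wide (size p).+1) ?size_polyMleq //; last first.
  by rewrite (leq_trans (size_polyMleq _ _)) // size_polyX.
rewrite big_ord_recl coefXM mul0r add0r; apply: eq_bigr => i _.
rewrite coefXM /=; congr (_ * c _); rewrite /bump leq0n; lia.
Qed.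

(** Integration by parts in algebraic form: multiply the Pearson recursion at index i - k by the
    i-th coefficient of p and sum over i. *)
Lemma moment_deriv (L : C) k p :
    (forall j : int, j%:~R * c j + L * (c (j + 1) - c (j - 1)) = 0) ->
  moment k ('X * p^`()) =
    k%:~R * moment k p - L * (moment (k - 1) p - moment (k + 1) p).
Proof.
move=> pearson; rewrite (@moment_wide (size p)); last first.
  apply/leq_sizeP => j pj; rewrite coefXM coef_deriv; case: j pj => //= j pj.
  by rewrite nth_default ?mul0rn.
rewrite /moment mulr_sumr -sumrB !mulr_sumr -sumrB; apply: eq_bigr => i _.
have -> : ('X * p^`())`_i = p`_i * i%:R.
  by rewrite coefXM coef_deriv; case: (nat_of_ord i) => [|j] /=; rewrite ?mulr0 // mulr_natr.
have := pearson (i%:Z - k).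
have -> : i%:Z - k + 1 = i%:Z - (k - 1) by lia.
have -> : i%:Z - k - 1 = i%:Z - (k + 1) by lia.
rewrite intrB -pmulrn => E.
apply/eqP; rewrite -subr_eq0; apply/eqP; rewrite -[RHS](mulr0 p`_i) -E.
ring.
Qed.

(** Reversing the summation index turns c(n - i - k) into the conjugate of c(i - (n - k)). *)
Lemma moment_star n k p : (forall j, c (- j) = (c j)^*) -> (size p <= n.+1)%N ->
  moment k (star_poly n p) = (moment (n%:Z - k) p)^*.
Proof.
move=> cN sp; rewrite (@moment_wide n.+1) ?size_poly // (moment_wide _ sp).
rewrite rmorph_sum (reindex_inj rev_ord_inj); apply: eq_bigr => i _ /=.
have le_in : (i <= n)%N by rewrite -ltnS.
rewrite coef_poly subSS subKn // ifT ?ltnS ?leq_subr // rmorphM /= -cN; congr (_ * c _).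
rewrite -subzn //; lia.
Qed.

End Moments.

(** * Szego theory and the polynomial identities, from the moments alone *)

Section Szego.
Context {R : realType}.
Local Notation C := R[i].
Variables (c : int -> C) (L : C) (Phi : nat -> {poly C}) (h : nat -> C).
Hypothesis L_neq0 : L != 0.
Hypothesis L_real : conjc L = L.
Hypothesis cN : forall j, c (- j) = conjc (c j).
Hypothesis pearson :
  forall j : int, j%:~R * c j + L * (c (j + 1) - c (j - 1)) = 0.
Hypothesis Phi_monic : forall n, Phi n \is monic.
Hypothesis size_Phi : forall n, size (Phi n) = n.+1.
Hypothesis h_neq0 : forall n, h n != 0.
Hypothesis moment_Phi_lt : forall n j, (j < n)%N -> moment c j%:Z (Phi n) = 0.
Hypothesis moment_Phi : forall n, moment c n%:Z (Phi n) = h n.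

(* a n is the Verblunsky coefficient alpha_(n-1), with a 0 = alpha_(-1) = -1. *)
Let a n : C := - (Phi n)`_0.
Let Phis n := star_poly n (Phi n).

(** Pearson at 0 gives c_1 = c_(-1), so c_0 and c_1 are real. As L is nonzero, Pearson at n + 1
    expresses c_(n+2) through c_n and c_(n+1), so the induction carries two consecutive moments;
    negative indices follow by conjugation. *)
Lemma sequence_real (j : int) : conjc (c j) = c j.
Proof.
have c1 : conjc (c 1) = c 1.
  have := pearson 0; rewrite mul0r !add0r => /eqP.
  by rewrite mulf_eq0 (negbTE L_neq0) subr_eq0 cN => /eqP.
have c0 : conjc (c 0) = c 0 by rewrite -cN oppr0.
have cn (n : nat) : conjc (c n%:Z) = c n%:Z /\ conjc (c n.+1%:Z) = c n.+1%:Z.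
  elim: n => [//|n [IH0 IH1]]; split=> //.
  have := pearson n.+1%:Z.
  have -> : n.+1%:Z + 1 = n.+2%:Z by lia.
  have -> : n.+1%:Z - 1 = n%:Z by lia.
  rewrite -pmulrn => E.
  have {}E : c n.+2%:Z = c n%:Z - n.+1%:R * c n.+1%:Z / L.
    apply/eqP; rewrite -subr_eq0; apply/eqP/(mulfI L_neq0); rewrite mulr0 -E.
    by field; exact L_neq0.
  by rewrite E rmorphB !rmorphM rmorph_nat fmorphV /= L_real IH0 IH1.
case: j => n; first exact: (cn n).1.
by rewrite NegzE cN conjcK; apply/esym; exact: (cn n.+1).1.
Qed.

(** Subtracting the multiple of [Phi n] with the same top coefficient lowers the size and keeps the
    lower moments zero, so by induction p is that multiple. The n-th moment then forces the multiple
    to be 0, since [h n] is nonzero. *)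
Lemma eq0_moments n (p : {poly C}) : (size p <= n)%N ->
  (forall j, (j < n)%N -> moment c j%:Z p = 0) -> p = 0.
Proof.
elim: n p => [|n IH] p; first by rewrite leqn0 size_poly_eq0 => /eqP.
move=> sp Mp; have E : p = p`_n *: Phi n.
  apply/eqP; rewrite -subr_eq0; apply/eqP/IH.
    apply/leq_sizeP => j; rewrite leq_eqVlt coefB coefZ => /predU1P[<-|nj].
      have := Phi_monic n; rewrite monicE lead_coefE size_Phi => /eqP ->.
      by rewrite mulr1 subrr.
    rewrite [p`_j]nth_default ?(leq_trans sp) // [(Phi n)`_j]nth_default ?size_Phi //.
    by rewrite mulr0 subrr.
  by move=> j jn; rewrite momentB momentZ Mp ?ltnS 1?ltnW // moment_Phi_lt // mulr0 subrr.
move: (Mp n (ltnSn n)); rewrite E momentZ moment_Phi => /eqP.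
by rewrite mulf_eq0 (negbTE (h_neq0 n)) orbF => /eqP ->; rewrite scale0r.
Qed.

(** The uniqueness principle used for all later identities: p is divisible by X, and dividing by X
    shifts the moments down by one, which reduces to [eq0_moments]. *)
Lemma eq0_moments_succ n (p : {poly C}) : (forall j, (n < j)%N -> p`_j = 0) -> p`_0 = 0 ->
  (forall j, (j < n)%N -> moment c j.+1%:Z p = 0) -> p = 0.
Proof.
elim/poly_ind: p => // p x _ sp; rewrite coefD coefMX coefC add0r => /= x0.
rewrite x0 addr0 in sp * => Mp; suff -> : p = 0 by rewrite mul0r.
apply: (@eq0_moments n); first by apply/leq_sizeP => j nj; have := sp j.+1; rewrite coefMX; exact.
move=> j jn; have := Mp j jn; rewrite mulrC momentMX.
by have -> : j.+1%:Z - 1 = j%:Z by lia.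
Qed.

(** As the moments are real, the polynomial with conjugated coefficients satisfies the same
    orthogonality relations. It is also monic, so the difference has size at most n and is 0. *)
Lemma Phi_coef_real n i : conjc (Phi n)`_i = (Phi n)`_i.
Proof.
pose P : {poly C} := \poly_(i < n.+1) conjc (Phi n)`_i.
have PE j : P`_j = conjc (Phi n)`_j.
  by rewrite coef_poly; case: ltnP => // nj; rewrite nth_default ?size_Phi // conjc0.
suff {2}-> : Phi n = P by rewrite PE.
apply/eqP; rewrite -subr_eq0; apply/eqP/(@eq0_moments n).
  apply/leq_sizeP => j; rewrite leq_eqVlt coefB PE => /predU1P[<-|nj].
    have := Phi_monic n; rewrite monicE lead_coefE size_Phi => /eqP ->.
    by rewrite conjc1 subrr.
  by rewrite !nth_default ?size_Phi // conjc0 subrr.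
move=> j jn; rewrite momentB moment_Phi_lt // sub0r -[RHS]oppr0; congr (- _).
rewrite -[RHS]conjc0 -(moment_Phi_lt jn) (@moment_wide _ _ n.+1) ?size_poly //.
rewrite /moment size_Phi rmorph_sum; apply: eq_bigr => k _.
by rewrite PE rmorphM /= sequence_real.
Qed.

Lemma alpha_real n : conjc (a n) = a n.
Proof. by rewrite /a rmorphN /= Phi_coef_real. Qed.

Lemma alphaN1 : a 0 = -1.
Proof.
have := Phi_monic 0; rewrite monicE lead_coefE size_Phi => /eqP <-.
by rewrite /a.
Qed.

Lemma coef_Phis n i : (Phis n)`_i = if (i <= n)%N then (Phi n)`_(n - i) else 0.
Proof. by rewrite coef_poly ltnS Phi_coef_real. Qed.

Lemma coef_Phi_lead n : (Phi n)`_n = 1.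
Proof. by have := Phi_monic n; rewrite monicE lead_coefE size_Phi => /eqP ->. Qed.

Lemma moment_Phis n k : moment c k (Phis n) = moment c (n%:Z - k) (Phi n).
Proof.
rewrite moment_star ?size_Phi //.
rewrite /moment rmorph_sum; apply: eq_bigr => i _.
by rewrite rmorphM /= sequence_real Phi_coef_real.
Qed.

Lemma moment_Phis_gt0 n (j : nat) : (0 < j <= n)%N -> moment c j%:Z (Phis n) = 0.
Proof.
move=> jn; rewrite moment_Phis.
have -> : n%:Z - j%:Z = (n - j)%N%:Z by lia.
apply: moment_Phi_lt; lia.
Qed.

Lemma moment_Phis0 n : moment c 0 (Phis n) = h n.
Proof. by rewrite moment_Phis subr0. Qed.

(** The leading terms cancel, the constant terms agree by the choice of [a n.+1], and both sides are
    orthogonal to z, ..., z^n. *)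
Lemma szego_recursion n : Phi n.+1 = 'X * Phi n - a n.+1 *: Phis n.
Proof.
apply/eqP; rewrite -subr_eq0; apply/eqP/(@eq0_moments_succ n).
- move=> j nj; rewrite !coefB coefZ coefXM coef_Phis leqNgt nj /= mulr0 subr0.
  case: j nj => //= j; rewrite ltnS leq_eqVlt => /predU1P[<-|nj].
    by rewrite !coef_Phi_lead subrr.
  by rewrite !nth_default ?size_Phi ?subrr.
- by rewrite !coefB coefZ coefXM coef_Phis subn0 coef_Phi_lead /a mulr1 sub0r opprK subrr.
move=> j jn; rewrite !momentB momentZ momentMX moment_Phi_lt //.
rewrite moment_Phis_gt0 //.
have -> : j.+1%:Z - 1 = j%:Z by lia.
by rewrite moment_Phi_lt // mulr0 !subr0.
Qed.

(** Read off from the vanishing 0-th moment of [Phi n.+1] through the Szego recursion. *)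
Lemma moment_PhiN1 n : moment c (-1) (Phi n) = a n.+1 * h n.
Proof.
have := @moment_Phi_lt n.+1 0%N isT.
rewrite szego_recursion momentB momentZ momentMX sub0r moment_Phis0 => /eqP.
by rewrite subr_eq0 => /eqP.
Qed.

Lemma moment_Phis_succ n : moment c n.+1%:Z (Phis n) = a n.+1 * h n.
Proof.
rewrite moment_Phis -moment_PhiN1; congr (moment c _ _); lia.
Qed.

Lemma h_succ n : h n.+1 = (1 - a n.+1 ^+ 2) * h n.
Proof.
rewrite -(moment_Phi n.+1) szego_recursion momentB momentZ momentMX moment_Phis_succ.
have -> : n.+1%:Z - 1 = n%:Z by lia.
rewrite moment_Phi; ring.
Qed.

(** With h_n = kappa_n^(-2) this is the factor b_n / b_(n+1) of the theorem, its n being n + 1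
    here. *)
Let rho n := h n.+1 / h n.

Lemma rhoE n : rho n = 1 - a n.+1 ^+ 2.
Proof. by rewrite /rho h_succ mulfK. Qed.

(** In this range both sides vanish except at j = 0, where they equal a_(n+2) h_(n+1). *)
Lemma moment_Phi_pred n j : (j <= n)%N ->
  moment c (j%:Z - 1) (Phi n.+1) = rho n * a n.+2 * moment c j%:Z (Phis n).
Proof.
case: j => [_|j jn].
  by rewrite sub0r moment_PhiN1 moment_Phis0 /rho; field.
rewrite moment_Phis_gt0 // mulr0.
have -> : j.+1%:Z - 1 = j%:Z by lia.
by rewrite moment_Phi_lt //; lia.
Qed.

(** In this range both sides vanish except at j = n, where they equal a_(n+1) h_(n+1). *)
Lemma moment_Phi_succ n j : (j <= n)%N ->
  a n.+1 * moment c j.+1%:Z (Phi n.+1) = rho n * moment c j.+1%:Z (Phis n).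
Proof.
rewrite leq_eqVlt => /predU1P[->|jn].
  by rewrite moment_Phi moment_Phis_succ /rho; field.
by rewrite moment_Phi_lt // moment_Phis_gt0 // !mulr0.
Qed.

(** The terms of degree n + 2 cancel because [Phi n.+1] is monic, the constant terms because rho = 1
    - a_(n+1)^2. In the moments, Pearson produces indices j - 1 and j + 1, which [moment_Phi_pred]
    and [moment_Phi_succ] match with the two terms in [Phis n]. *)
Lemma Phi_deriv_eq n :
  'X * ('X * (Phi n.+1)^`()) =
    n.+1%:R *: ('X * Phi n.+1) + (L - L * a n.+1 ^+ 2) *: Phi n.+1
    + (L * rho n * a n.+1) *: Phis n - (L * rho n * a n.+2) *: ('X * Phis n).
Proof.
apply/eqP; rewrite -subr_eq0; apply/eqP/(@eq0_moments_succ n.+1).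
- move=> j nj; rewrite !(coefB, coefD, coefZ, coefXM) !coef_Phis coef_deriv.
  case: j nj => // j; rewrite ltnS => nj /=.
  rewrite (leqNgt j n) nj (ltnNge j n) ltnW //=.
  rewrite [(Phi _)`_j.+1]nth_default ?size_Phi ?ltnS // !mulr0 !addr0 subr0.
  case: j nj => //= j; rewrite ltnS leq_eqVlt => /predU1P[<-|nj].
    by rewrite mulr_natl subrr.
  by rewrite nth_default ?size_Phi // mul0rn mulr0 subrr.
- rewrite !(coefB, coefD, coefZ, coefXM) !coef_Phis /= subn0 coef_Phi_lead rhoE.
  have -> : (Phi n.+1)`_0 = - a n.+1 by rewrite /a opprK.
  ring.
move=> j jn; rewrite !(momentB, momentD, momentZ) momentMX.
have jE : j.+1%:Z - 1 = j%:Z by lia.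
rewrite jE (moment_deriv _ _ pearson) !momentMX !jE moment_Phi_lt // moment_Phi_pred //.
have -> : j%:Z + 1 = j.+1%:Z by lia.
have := @moment_Phi_succ n j jn; set x := moment c _ (Phi n.+1).
set y := moment c j.+1%:Z _ => E.
transitivity (L * a n.+1 * (a n.+1 * x - rho n * y)); first by ring.
by rewrite E subrr mulr0.
Qed.

(** The terms of degree n + 2 cancel because the coefficient of z^n in [Phis n] is Phi_n(0) = -a_n.
    In the moments, index j - 1 of [Phis n] occurs on both sides, and index j + 1 is handled by
    [moment_Phi_succ]. *)
Lemma Phis_deriv_eq n :
  'X * ('X * (Phis n)^`()) =
    (L * a n.+1) *: Phi n.+1 - (L * a n) *: ('X * Phi n.+1)
    - L *: ('X * ('X * Phis n)) + (L * a n.+1 ^+ 2) *: Phis n.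
Proof.
apply/eqP; rewrite -subr_eq0; apply/eqP/(@eq0_moments_succ n.+1).
- move=> j nj; rewrite !(coefB, coefD, coefZ, coefXM) coef_deriv.
  case: j nj => // j; rewrite ltnS => nj /=.
  rewrite [(Phi _)`_j.+1]nth_default ?size_Phi ?ltnS // !mulr0 sub0r.
  case: j nj => //= j nj.
  rewrite !coef_Phis (leqNgt j.+1) nj (leqNgt j.+2) leqW //= mul0rn mulr0 addr0.
  move: nj; rewrite ltnS leq_eqVlt => /predU1P[<-|nj].
    by rewrite leqnn subnn coef_Phi_lead /a; ring.
  by rewrite leqNgt nj /= nth_default ?size_Phi // !mulr0 subr0 oppr0 subr0.
- rewrite !(coefB, coefD, coefZ, coefXM) !coef_Phis /= subn0 coef_Phi_lead.
  have -> : (Phi n.+1)`_0 = - a n.+1 by rewrite /a opprK.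
  ring.
move=> j jn; rewrite !(momentB, momentD, momentZ) momentMX.
have jE : j.+1%:Z - 1 = j%:Z by lia.
rewrite jE (moment_deriv _ _ pearson) !momentMX !jE (moment_Phi_lt jn).
have -> : j%:Z + 1 = j.+1%:Z by lia.
have := @moment_Phi_succ n j jn; rewrite rhoE.
(* At j = 0 the moment is [h n], not 0; there the factor j makes the product vanish. *)
have : j%:~R * moment c j%:Z (Phis n) = 0.
  by case: (j) jn => [|i] jn0; rewrite ?mul0r // moment_Phis_gt0 // mulr0.
set u := _ * moment c j%:Z (Phis n) => ->; set x := moment c _ (Phi n.+1).
set y := moment c j.+1%:Z _ => E.
transitivity (L * ((1 - a n.+1 ^+ 2) * y - a n.+1 * x)); first by ring.
by rewrite E subrr mulr0.
Qed.

End Szego.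

(** * Calculus of complex-valued functions of a real variable *)

Section ComplexPaths.
Context {R : realType}.
Local Notation C := R[i].
Implicit Types (f g df dg : R -> C) (t : R).

Definition path_deriv f df := forall t : R,
  is_derive t (1 : R) (fun x => complex.Re (f x)) (complex.Re (df t)) /\
  is_derive t (1 : R) (fun x => complex.Im (f x)) (complex.Im (df t)).

(** Only differentiability on the whole line is asked. This yields continuity, hence integrability
    on segments, and is stable under the algebraic operations. *)
Definition path_smooth f := exists df, path_deriv f df.

Lemma ReD (x y : C) : complex.Re (x + y) = complex.Re x + complex.Re y.
Proof. by case: x y => [a b] []. Qed.

Lemma ImD (x y : C) : complex.Im (x + y) = complex.Im x + complex.Im y.
Proof. by case: x y => [a b] []. Qed.

Lemma ReM (x y : C) : complex.Re (x * y) =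
  complex.Re x * complex.Re y - complex.Im x * complex.Im y.
Proof. by case: x y => [a b] []. Qed.

Lemma ImM (x y : C) : complex.Im (x * y) =
  complex.Re x * complex.Im y + complex.Im x * complex.Re y.
Proof. by case: x y => [a b] []. Qed.

Lemma path_deriv_cst a : path_deriv (fun=> a) (fun=> 0).
Proof. by move=> t; split; exact: is_derive_cst. Qed.

Lemma path_derivD f df g dg : path_deriv f df -> path_deriv g dg ->
  path_deriv (fun t => f t + g t) (fun t => df t + dg t).
Proof.
move=> Hf Hg t; have [f1 f2] := Hf t; have [g1 g2] := Hg t.
rewrite ReD ImD; split.
  have -> : (fun x => complex.Re (f x + g x)) =
      (fun x => complex.Re (f x)) + (fun x => complex.Re (g x)).
    by apply/funext => x; rewrite ReD.
  exact: is_deriveD.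
have -> : (fun x => complex.Im (f x + g x)) =
    (fun x => complex.Im (f x)) + (fun x => complex.Im (g x)).
  by apply/funext => x; rewrite ImD.
exact: is_deriveD.
Qed.

Lemma path_derivM f df g dg : path_deriv f df -> path_deriv g dg ->
  path_deriv (fun t => f t * g t) (fun t => df t * g t + f t * dg t).
Proof.
move=> Hf Hg t; have [f1 f2] := Hf t; have [g1 g2] := Hg t.
rewrite ReD ImD !ReM !ImM; split.
  have -> : (fun x => complex.Re (f x * g x)) =
      (fun x => complex.Re (f x)) * (fun x => complex.Re (g x)) -
      (fun x => complex.Im (f x)) * (fun x => complex.Im (g x)).
    by apply/funext => x; rewrite ReM.
  apply: is_derive_eq; rewrite /GRing.scale /=; ring.
have -> : (fun x => complex.Im (f x * g x)) =
    (fun x => complex.Re (f x)) * (fun x => complex.Im (g x)) +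
    (fun x => complex.Im (f x)) * (fun x => complex.Re (g x)).
  by apply/funext => x; rewrite ImM.
apply: is_derive_eq; rewrite /GRing.scale /=; ring.
Qed.

Lemma path_derivV f df : (forall t, f t != 0) -> path_deriv f df ->
  path_deriv (fun t => (f t)^-1) (fun t => - df t / f t ^+ 2).
Proof.
move=> f0 Hf.
have n0 t : complex.Re (f t) ^+ 2 + complex.Im (f t) ^+ 2 != 0.
  have := f0 t; apply: contra; rewrite paddr_eq0 ?sqr_ge0 // !sqrf_eq0.
  by rewrite eq_complex.
have ReV (x : C) : complex.Re x^-1 = complex.Re x / (complex.Re x ^+ 2 + complex.Im x ^+ 2).
  by case: x.
have ImV (x : C) : complex.Im x^-1 = - complex.Im x / (complex.Re x ^+ 2 + complex.Im x ^+ 2).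
  by case: x => [a b] /=; rewrite mulNr.
move=> t; have [f1 f2] := Hf t.
pose u x := complex.Re (f x); pose v x := complex.Im (f x).
pose N x := u x * u x + v x * v x.
have n1 : N t != 0 by have := n0 t; rewrite !expr2.
have dN : is_derive t (1 : R) N (2 * u t * complex.Re (df t) + 2 * v t * complex.Im (df t)).
  have -> : N = (u : R -> R) * u + (v : R -> R) * v by [].
  apply: is_derive_eq; rewrite /GRing.scale /= /u /v; ring.
have dV := is_deriveV n1 dN.
split.
  have -> : (fun x => complex.Re (f x)^-1) = (u : R -> R) * (fun x => (N x)^-1).
    by apply/funext => x; rewrite ReV !expr2.
  apply: is_derive_eq; rewrite /GRing.scale /= !(ReM, ImM, ReV, ImV, expr2).
  move: n1; rewrite /N /u /v; case: (f t) (df t) => [a b] [da db] /= n1.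
  (* The other denominator comes from inverting f^2: it is the squared modulus of f^2, that is (a^2
     + b^2)^2. *)
  field; rewrite n1 andbT.
  rewrite (_ : _ + _ = (a * a + b * b) ^+ 2) ?expf_neq0 //; ring.
rewrite [X in is_derive _ _ X _](_ : _ = - ((v : R -> R) * (fun x => (N x)^-1))); last first.
  by apply/funext => x; rewrite ImV !expr2 mulNr.
apply: is_derive_eq; rewrite /GRing.scale /= !(ReM, ImM, ReV, ImV, expr2).
move: n1; rewrite /N /u /v; case: (f t) (df t) => [a b] [da db] /= n1.
field; rewrite n1 andbT.
rewrite (_ : _ + _ = (a * a + b * b) ^+ 2) ?expf_neq0 //; ring.
Qed.

Lemma path_deriv_horner p f df : path_deriv f df ->
  path_deriv (fun t => p.[f t]) (fun t => (p^`()).[f t] * df t).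
Proof.
move=> Hf; elim/poly_ind: p => [|p a IH].
  have := path_deriv_cst 0; congr path_deriv; apply/funext => t; rewrite ?deriv0 horner0 //.
  by rewrite mul0r.
have := path_derivD (path_derivM IH Hf) (path_deriv_cst a).
congr path_deriv; apply/funext => t; first by rewrite hornerMXaddC.
by rewrite derivD derivC derivM derivX mulr1 !hornerD hornerMX horner0; ring.
Qed.

Lemma path_smooth_cst a : path_smooth (fun=> a).
Proof. by exists (fun=> 0); exact: path_deriv_cst. Qed.

Lemma path_smoothD f g : path_smooth f -> path_smooth g ->
  path_smooth (fun t => f t + g t).
Proof. by move=> [df Hf] [dg Hg]; eexists; exact: path_derivD. Qed.

Lemma path_smoothM f g : path_smooth f -> path_smooth g ->
  path_smooth (fun t => f t * g t).
Proof. by move=> [df Hf] [dg Hg]; eexists; exact: path_derivM. Qed.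

Lemma path_smoothV f : (forall t, f t != 0) -> path_smooth f ->
  path_smooth (fun t => (f t)^-1).
Proof. by move=> f0 [df Hf]; eexists; exact: path_derivV. Qed.

Lemma path_smooth_horner p f : path_smooth f -> path_smooth (fun t => p.[f t]).
Proof. by move=> [df Hf]; eexists; exact: path_deriv_horner. Qed.

Lemma path_smoothX n f : path_smooth f -> path_smooth (fun t => f t ^+ n).
Proof.
move=> /(path_smooth_horner 'X^n); congr path_smooth.
by apply/funext => t; rewrite hornerXn.
Qed.

Lemma path_smooth_continuous f : path_smooth f ->
  continuous (fun x => complex.Re (f x)) /\ continuous (fun x => complex.Im (f x)).
Proof.
move=> [df Hf]; split=> t; have [[d1 _] [d2 _]] := Hf t.
  exact/differentiable_continuous/derivable1_diffP.
exact/differentiable_continuous/derivable1_diffP.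
Qed.

(** * Integrals of such paths over a segment *)

Section Integral.
Variables (a b : R).
Local Notation I := (cRintegral a b).

Lemma path_smooth_integrable f : path_smooth f ->
  lebesgue_measure.-integrable `[a, b]%classic (EFin \o (fun x => complex.Re (f x))) /\
  lebesgue_measure.-integrable `[a, b]%classic (EFin \o (fun x => complex.Im (f x))).
Proof.
move=> /path_smooth_continuous [c1 c2].
by split; apply: continuous_compact_integrable; do ?exact: segment_compact;
  exact: continuous_subspaceT.
Qed.

Lemma cRintegralD f g : path_smooth f -> path_smooth g ->
  I (fun t => f t + g t) = I f + I g.
Proof.
move=> /path_smooth_integrable [f1 f2] /path_smooth_integrable [g1 g2].
rewrite /cRintegral; under eq_Rintegral do rewrite ReD.
under [X in _ +i* X]eq_Rintegral do rewrite ImD.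
by rewrite !RintegralD.
Qed.

Lemma cRintegralZ (k : C) f : path_smooth f -> I (fun t => k * f t) = k * I f.
Proof.
case: k => [p q] /path_smooth_integrable [f1 f2].
have iZ (r : R) (g : R -> R) : lebesgue_measure.-integrable `[a, b]%classic (EFin \o g) ->
    lebesgue_measure.-integrable `[a, b]%classic (EFin \o (fun x => r * g x)).
  by move=> ig; exact: integrableZl ig.
rewrite /cRintegral; under eq_Rintegral do rewrite ReM /=.
under [X in _ +i* X]eq_Rintegral do rewrite ImM /=.
rewrite RintegralB ?RintegralD ?RintegralZl //; exact: iZ.
Qed.

Lemma cRintegral_conj f : path_smooth f -> I (fun t => conjc (f t)) = conjc (I f).
Proof.
move=> /path_smooth_integrable [f1 f2].
have cE (z : C) : complex.Re (conjc z) = complex.Re z /\ complex.Im (conjc z) = -1 * complex.Im z.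
  by case: z => u v /=; rewrite mulN1r.
rewrite /cRintegral; under eq_Rintegral do rewrite (cE _).1.
under [X in _ +i* X]eq_Rintegral do rewrite (cE _).2.
by rewrite RintegralZl // mulN1r.
Qed.

Lemma cRintegral_deriv f df : a < b -> path_deriv f df -> path_smooth df ->
  I df = f b - f a.
Proof.
move=> ab Hf /path_smooth_continuous [c1 c2].
have [f1 f2] := path_smooth_continuous (ex_intro _ df Hf).
rewrite /cRintegral /Rintegral.
rewrite (@continuous_FTC2 _ _ (fun x => complex.Re (f x))) //; last first.
- by move=> x _; rewrite derive1E; have [[_ ->] _] := Hf x.
- split; last 2 first.
  + exact/cvg_at_right_filter/f1.
  + exact/cvg_at_left_filter/f1.
  by move=> x _; have [[]] := Hf x.
- exact: continuous_subspaceT.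
rewrite (@continuous_FTC2 _ _ (fun x => complex.Im (f x))) //; last first.
- by move=> x _; rewrite derive1E; have [_ [_ ->]] := Hf x.
- split; last 2 first.
  + exact/cvg_at_right_filter/f2.
  + exact/cvg_at_left_filter/f2.
  by move=> x _; have [_ []] := Hf x.
- exact: continuous_subspaceT.
by rewrite /=; case: (f b) (f a) => [u v] [w y].
Qed.

Lemma normc_real (x : R) : `|x%:C| = `|x|%:C.
Proof. by rewrite normc_def /= expr0n addr0 sqrtr_sqr. Qed.

Lemma normc_ge_Im (z : C) : `|complex.Im z|%:C <= `|z|.
Proof.
case: z => u v; rewrite normc_def /= lecR -sqrtr_sqr.
by apply: ler_wsqrtr; rewrite lerDr sqr_ge0.
Qed.

(** Real and imaginary parts are estimated separately, whence the factor 2; the bound serves to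
    control a remainder, so its constant is immaterial. *)
Lemma cRintegral_bound (M : C) f : a <= b -> path_smooth f ->
  (forall t, a <= t <= b -> `|f t| <= M) -> `|I f| <= 2 * (M * (b - a)%:C).
Proof.
move=> ab sf fM; have [f1 f2] := path_smooth_integrable sf.
have M0 : 0 <= M by apply: le_trans (normr_ge0 _) (fM a _); rewrite lexx.
(* A nonnegative element of [R[i]] is real, so M may be replaced by its real part. *)
move: fM; rewrite -(RRe_real (ger0_real M0)); move: (complex.Re M) => {M0}M fM.
have cM : lebesgue_measure.-integrable `[a, b]%classic (EFin \o (fun=> M)).
  apply: continuous_compact_integrable; first exact: segment_compact.
  by apply: continuous_subspaceT => x; exact: cvg_cst.
have key (g : R -> R) : lebesgue_measure.-integrable `[a, b]%classic (EFin \o g) ->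
    (forall t, a <= t <= b -> `|g t| <= M) ->
    `|\int[lebesgue_measure]_(x in `[a, b]%classic) g x| <= M * (b - a).
  move=> ig gM; apply: (le_trans (le_normr_Rintegral _ ig)) => //.
  apply: (@le_trans _ _ (\int[lebesgue_measure]_(x in `[a, b]%classic) M)).
    by apply: le_Rintegral => //; exact: (integrable_abse ig).
  have mE : fine (lebesgue_measure (`[a, b]%classic : set R)) = b - a.
    rewrite lebesgue_measure_itv /= lte_fin.
    by move: ab; rewrite le_eqVlt => /predU1P[->|->] /=; rewrite ?ltxx ?subrr.
  have -> := Rintegral_cst lebesgue_measure (measurable_itv `[a, b]) M.
  by rewrite -mE.
have K1 : `|complex.Re (I f)| <= M * (b - a).
  by apply: key => // t tab; rewrite -lecR; apply: le_trans (fM t tab); exact: normc_ge_Re.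
have K2 : `|complex.Im (I f)| <= M * (b - a).
  by apply: key => // t tab; rewrite -lecR; apply: le_trans (fM t tab); exact: normc_ge_Im.
rewrite [I f]complexE; apply: (le_trans (ler_normD _ _)).
rewrite normrM !normc_real complexiE normCi mul1r.
rewrite -[2 * _](_ : (2 * (M * (b - a)))%:C = _) ?rmorphM //; last by rewrite rmorph_nat.
rewrite lecE; apply/andP; split; first by rewrite /= !(mul0r, mulr0, addr0).
by rewrite /= !mul0r !subr0 mulr_natl mulr2n lerD.
Qed.

Lemma path_smooth_bounded f : a <= b -> path_smooth f ->
  exists M : C, forall t, a <= t <= b -> `|f t| <= M.
Proof.
move=> ab sf; have [c1 c2] := path_smooth_continuous sf.
have bnd (g : R -> R) : continuous g -> exists M, forall t, a <= t <= b -> `|g t| <= M.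
  move=> cg.
  have [//|u _ gu] := @EVT_max _ g a b ab; first exact: continuous_subspaceT.
  have [//|v _ gv] := @EVT_min _ g a b ab; first exact: continuous_subspaceT.
  exists (`|g u| + `|g v|) => t tab.
  have tI : t \in `[a, b] by rewrite in_itv.
  have {}gu := gu t tI; have {}gv := gv t tI.
  rewrite ler_norml; have := ler_norm (g u); have := ler_norm (- g v).
  rewrite normrN; have := normr_ge0 (g u); have := normr_ge0 (g v); lra.
have [M1 HM1] := bnd _ c1; have [M2 HM2] := bnd _ c2.
exists (M1 + M2)%:C => t tab.
rewrite [f t]complexE; apply: (le_trans (ler_normD _ _)).
rewrite normrM !normc_real complexiE normCi mul1r.
by rewrite lecE; apply/andP; split; rewrite /= ?addr0 ?lerD ?HM1 ?HM2.
Qed.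

Lemma cRintegral_sum n (k : 'I_n -> C) (F : 'I_n -> R -> C) : (forall i, path_smooth (F i)) ->
  I (fun t => \sum_(i < n) k i * F i t) = \sum_(i < n) k i * I (F i).
Proof.
move=> sF.
(* Smoothness of the partial sums is carried through the induction, since additivity of the integral
   requires it. *)
suff [_ ->] : path_smooth (fun t => \sum_(i < n) k i * F i t) /\
   I (fun t => \sum_(i < n) k i * F i t) = \sum_(i < n) k i * I (F i) by [].
elim: n k F sF => [|n IH] k F sF.
  have -> : (fun t => \sum_(i < 0) k i * F i t) = fun=> 0 by apply/funext => t; rewrite big_ord0.
  split; first exact: path_smooth_cst.
  have := @cRintegralZ 0 (fun=> 0) (path_smooth_cst 0).
  by rewrite !mul0r big_ord0.
have [s1 E1] := IH (fun i => k (widen_ord (leqnSn n) i))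
  (fun i => F (widen_ord (leqnSn n) i)) (fun i => sF _).
have s2 : path_smooth (fun t => k ord_max * F ord_max t).
  by apply: path_smoothM => //; exact: path_smooth_cst.
have -> : (fun t => \sum_(i < n.+1) k i * F i t) =
  (fun t => \sum_(i < n) k (widen_ord (leqnSn n) i) * F (widen_ord (leqnSn n) i) t
    + k ord_max * F ord_max t).
  by apply/funext => t; rewrite big_ord_recr.
split; first exact: path_smoothD.
by rewrite cRintegralD // cRintegralZ // big_ord_recr /= E1.
Qed.

End Integral.

End ComplexPaths.

(** * The Bessel weight on the unit circle, its moments and Cauchy transforms *)

Section Circle.
Context {R : realType}.
Local Notation C := R[i].
Local Notation twopi := (2 * pi : R).
Variable l : R.
Implicit Types (p q : {poly C}) (z : C).

Local Notation e := (fun t : R => cos t +i* sin t).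
Local Notation w := (fun t : R => (expR (l * cos t))%:C).
Local Notation L := (l%:C / 2 : C).
Local Notation I := (cRintegral 0 twopi).

Lemma cexp_circle (t : R) : cexp ('i%R * t%:C) = e t.
Proof.
by rewrite -complexiE /cexp /= !(mul0r, mulr0, mul1r, subr0, oppr0, add0r, addr0, expR0).
Qed.

Lemma twopi_gt0 : 0 < twopi.
Proof. by rewrite mulr_gt0 ?pi_gt0. Qed.

Lemma circle_norm (t : R) : `|e t| = 1.
Proof. by rewrite normc_def /= cos2Dsin2 sqrtr1. Qed.

Lemma circle_neq0 (t : R) : e t != 0.
Proof. by rewrite -normr_eq0 circle_norm oner_eq0. Qed.

Lemma circle_conj (t : R) : conjc (e t) = (e t)^-1.
Proof.
apply: (mulfI (circle_neq0 t)); rewrite divff ?circle_neq0 //.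
by rewrite -sqr_normc circle_norm expr1n.
Qed.

Lemma nu_bessel_circle (t : R) : nu_bessel l (e t) = w t.
Proof.
rewrite /nu_bessel -circle_conj.
have -> : l%:C * (e t + conjc (e t)) / 2 = (l * cos t)%:C.
  by rewrite addcJ /= mulrCA mulrAC divff ?mul1r ?pnatr_eq0 // -rmorphM.
by rewrite /cexp /= cos0 sin0; exact: mulr1.
Qed.

Lemma circle_integralE (f : C -> C) :
  circle_integral f = I (fun t => f (e t) * ('i * e t)).
Proof. by rewrite /circle_integral; congr cRintegral; apply/funext => t; rewrite cexp_circle. Qed.

Lemma path_deriv_circle : path_deriv e (fun t => 'i%R * e t).
Proof.
move=> t; rewrite -complexiE /= !mul0r !mul1r sub0r add0r.
by split; [exact: is_derive_cos|exact: is_derive_sin].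
Qed.

(** The derivative -l sin(t) nu is rewritten with z - 1/z = 2 i sin(t), so that only powers of z and
    the weight occur; the Pearson recursion comes from this form. *)
Lemma path_deriv_weight : path_deriv w (fun t => 'i%R * (L * (e t - (e t)^-1)) * w t).
Proof.
have -> : (fun t => 'i%R * (L * (e t - (e t)^-1)) * w t) =
   (fun t => (- (l * sin t * expR (l * cos t)))%:C).
  apply/funext => t; rewrite -circle_conj -complexiE.
  rewrite subcJ rmorphN !rmorphM /=.
  set S := (sin t)%:C; set W := (expR _)%:C.
  by rewrite -[RHS]mulN1r -sqr_i; field.
move=> t; split; last exact: is_derive_cst.
have D1 : is_derive t (1 : R) (fun x => l * cos x) (l * - sin t) by exact: is_deriveZ.
have D2 := @is_derive1_comp R expR (fun x => l * cos x) t _ _ (is_derive_expR _) D1.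
by apply: (is_derive_eq D2); rewrite /=; ring.
Qed.

Lemma path_smooth_circle : path_smooth e.
Proof. by eexists; exact: path_deriv_circle. Qed.

Lemma path_smooth_weight : path_smooth w.
Proof. by eexists; exact: path_deriv_weight. Qed.

Lemma path_deriv_circleX (k : int) :
  path_deriv (fun t => e t ^ k) (fun t => 'i%R * k%:~R * e t ^ k).
Proof.
have pos n : path_deriv (fun t => e t ^+ n) (fun t => 'i%R * n%:R * e t ^+ n).
  have := path_deriv_horner 'X^n path_deriv_circle.
  congr path_deriv; apply/funext => t; first by rewrite hornerXn.
  rewrite derivXn hornerMn hornerXn; case: n => [|n] /=; first by rewrite !mulr0n !(mulr0, mul0r).
  by rewrite -[_ *+ _]mulr_natr exprS; ring.
case: k => n; first exact: pos.
have := path_derivV (fun t => expf_neq0 n.+1 (circle_neq0 t)) (pos n.+1).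
congr path_deriv; apply/funext => t.
rewrite NegzE -exprnN mulrNz -pmulrn; field.
exact: expf_neq0 (circle_neq0 t).
Qed.

Lemma path_smooth_circleX (k : int) : path_smooth (fun t => e t ^ k).
Proof. by eexists; exact: path_deriv_circleX. Qed.

Definition bessel_moment (k : int) : C := I (fun t => e t ^ k * w t).

Lemma bessel_momentN k : bessel_moment (- k) = conjc (bessel_moment k).
Proof.
rewrite /bessel_moment -cRintegral_conj; last first.
  by apply: path_smoothM; [exact: path_smooth_circleX|exact: path_smooth_weight].
congr cRintegral; apply/funext => t.
rewrite rmorphM; congr (_ * _); last by rewrite /= oppr0.
case: k => n; first by rewrite -exprnN -exprVn -circle_conj rmorphXn.
rewrite NegzE opprK -exprnN -exprVn -circle_conj rmorphXn.
by congr (_ ^+ _); rewrite /= opprK.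
Qed.

Lemma bessel_pearson (k : int) :
  k%:~R * bessel_moment k + L * (bessel_moment (k + 1) - bessel_moment (k - 1)) = 0.
Proof.
have D := path_derivM (path_deriv_circleX k) path_deriv_weight.
have sw j : path_smooth (fun t => e t ^ j * w t).
  by apply: path_smoothM; [exact: path_smooth_circleX|exact: path_smooth_weight].
have sZ (a : C) f : path_smooth f -> path_smooth (fun t => a * f t).
  by move=> sf; apply: path_smoothM => //; exact: path_smooth_cst.
have E : (fun t => 'i%R * k%:~R * e t ^ k * w t + e t ^ k * ('i%R * (L * (e t - (e t)^-1)) * w t)) =
  (fun t => 'i%R * k%:~R * (e t ^ k * w t) +
     ('i%R * L * (e t ^ (k + 1) * w t) + - ('i%R * L) * (e t ^ (k - 1) * w t))).
  by apply/funext => t; rewrite !expfzDr ?circle_neq0 // expr1z exprN1; ring.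
rewrite E in D.
have := cRintegral_deriv twopi_gt0 D
  (path_smoothD (sZ _ _ (sw _)) (path_smoothD (sZ _ _ (sw _)) (sZ _ _ (sw _)))).
rewrite !cRintegralD; do ?[exact: sZ|apply: path_smoothD]; rewrite ?cRintegralZ //.
(* The primitive depends on t through cos t and sin t only, so its increment over a full period is
   0. *)
have -> : cos twopi = cos 0 :> R by rewrite mulr_natl cos2pi cos0.
have -> : sin twopi = sin 0 :> R by rewrite mulr_natl sin2pi sin0.
rewrite subrr -/(bessel_moment k) -/(bessel_moment (k + 1)) -/(bessel_moment (k - 1)) => H.
apply: (mulfI (@neq0Ci C)); rewrite mulr0 -[RHS]H; ring.
Qed.

Lemma momentE p (k : int) : I (fun t => p.[e t] * e t ^ (- k) * w t) = moment bessel_moment k p.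
Proof.
have sw j : path_smooth (fun t => e t ^ j * w t).
  by apply: path_smoothM; [exact: path_smooth_circleX|exact: path_smooth_weight].
rewrite /moment /bessel_moment -cRintegral_sum //; congr cRintegral; apply/funext => t.
rewrite horner_coef !mulr_suml; apply: eq_bigr => i _.
by rewrite -!mulrA; congr (_ * _); rewrite mulrA expfzDr ?circle_neq0.
Qed.

(** The integrand p(z) nu(z) z^(-n) dz pulled back to the parameter; the last factor is dz/dt. *)
Definition weighted_path p (n : nat) (t : R) : C := p.[e t] * (w t / e t ^+ n) * ('i%R * e t).

Lemma weighted_path_smooth p n : path_smooth (weighted_path p n).
Proof.
apply: path_smoothM; last by apply: path_smoothM;
  [exact: path_smooth_cst|exact: path_smooth_circle].
apply: path_smoothM; first exact/path_smooth_horner/path_smooth_circle.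
apply: path_smoothM; first exact: path_smooth_weight.
apply: path_smoothV; first by move=> t; rewrite expf_neq0 // circle_neq0.
exact/path_smoothX/path_smooth_circle.
Qed.

(** The factor z in dz/dt = i z turns the exponent -n into -(n - 1). *)
Lemma cRintegral_weighted_path p n :
  I (weighted_path p n) = 'i%R * moment bessel_moment (n%:Z - 1) p.
Proof.
rewrite -momentE -cRintegralZ; last first.
  apply: path_smoothM; last exact: path_smooth_weight.
  by apply: path_smoothM; [exact/path_smooth_horner/path_smooth_circle|exact: path_smooth_circleX].
congr cRintegral; apply/funext => t; rewrite /weighted_path opprB expfzDr ?circle_neq0 // expr1z.
by rewrite -exprnN; field; rewrite expf_neq0 // circle_neq0.
Qed.

Section OffCircle.
Variable z : C.
Hypothesis z1 : `|z| != 1.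

(** The distance from z to the unit circle, a lower bound for the Cauchy denominator that is uniform
    in t. *)
Let dist : C := `|1 - `|z| |.

Lemma dist_circle_gt0 : 0 < dist.
Proof. by rewrite normr_gt0 subr_eq0 eq_sym. Qed.

Lemma dist_circle_le (t : R) : dist <= `|e t - z|.
Proof. by rewrite /dist -(circle_norm t) ler_dist_dist. Qed.

Lemma sub_circle_neq0 (t : R) : e t - z != 0.
Proof. by rewrite -normr_gt0 (lt_le_trans dist_circle_gt0) // dist_circle_le. Qed.

Lemma path_smooth_sub_circle : path_smooth (fun t => e t - z).
Proof. by apply: path_smoothD; [exact: path_smooth_circle|exact: path_smooth_cst]. Qed.

Lemma path_smooth_div_circle (f : R -> C) : path_smooth f -> path_smooth (fun t => f t / (e t - z)).
Proof.
move=> sf; apply: path_smoothM => //.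
by apply: path_smoothV; [exact: sub_circle_neq0|exact: path_smooth_sub_circle].
Qed.

End OffCircle.

(** Differentiation under the integral sign without a limit theorem: 1/(t-z-h) = 1/(t-z) + h/(t-z)^2
    + h^2/((t-z)^2 (t-z-h)) is exact, and the integral of the last quotient stays bounded as h tends
    to 0. *)
Lemma cauchy_transform_derive (f : R -> C) z : `|z| != 1 -> path_smooth f ->
  is_derive (z : C^o) (1 : C^o) (fun z : C^o => I (fun t => f t / (e t - z)) : C^o)
    (I (fun t => f t / (e t - z) / (e t - z))).
Proof.
move=> z1 sf.
have s1 := path_smooth_div_circle z1 sf.
have s2 := path_smooth_div_circle z1 s1.
have [M HM] := path_smooth_bounded (ltW twopi_gt0) s2.
set d : C := `|1 - `|z| |; have d0 : 0 < d by exact: dist_circle_gt0.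
set F := fun z : C => I (fun t => f t / (e t - z)).
set F2 := I (fun t => f t / (e t - z) / (e t - z)).
(* M bounds |f/(e-z)^2| on the segment, and 2/d bounds 1/|e-z-h| once |h| < d/2. *)
pose B : C := 2 * (M * (2 / d) * (twopi - 0)%:C).
have M0 : 0 <= M by apply: le_trans (HM 0 _); rewrite ?normr_ge0 // lexx ltW ?twopi_gt0.
have B0 : 0 <= B.
  by rewrite !mulr_ge0 ?invr_ge0 ?(ltW d0) // subr0 ler0c ltW ?twopi_gt0.
have taylor (h : C) : `|h| < d / 2 -> exists2 J : C,
    F (h + z) = F z + h * F2 + h * (h * J) & `|J| <= B.
  move=> hd.
  (* If z + h were on the circle, the distance d would be at most |h| < d/2. *)
  have hz1 : `|h + z| != 1.
    apply/eqP => E; have := ler_dist_dist (h + z) z.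
    rewrite E addrK => /le_lt_trans/(_ hd); rewrite -/d => dd.
    have /(lt_trans dd) : d / 2 < d by rewrite ltr_pdivrMr ?ltr0n // ltr_pMr // ltr1n.
    by rewrite ltxx.
  have s3 := path_smooth_div_circle hz1 s2.
  exists (I (fun t => f t / (e t - z) / (e t - z) / (e t - (h + z)))).
    rewrite /F /F2.
    have sZ (a : C) g : path_smooth g -> path_smooth (fun t => a * g t).
      by move=> sg; apply: path_smoothM => //; exact: path_smooth_cst.
    have s4 := sZ h _ s3.
    rewrite -!cRintegralZ -?cRintegralD;
      do ?[exact: s4|exact: s1|exact: s2|exact: s3|apply: sZ|apply: path_smoothD].
    congr cRintegral; apply/funext => t; field.
    by rewrite !(sub_circle_neq0 _) // -addrA.
  rewrite /B; apply: (@cRintegral_bound R 0 twopi (M * (2 / d)) _ (ltW twopi_gt0) s3) => t tI.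
  rewrite normrM ler_pM ?normr_ge0 ?HM // normfV -invf_div.
  have n0 : 0 < `|e t - (h + z)| by rewrite normr_gt0 sub_circle_neq0.
  rewrite lef_pV2 ?posrE ?divr_gt0 //.
  have -> : e t - (h + z) = (e t - z) - h by rewrite opprD addrA addrAC.
  apply: le_trans (lerB_dist _ _); rewrite lerBrDr.
  apply: (le_trans _ (dist_circle_le z t)); rewrite -/d.
  by rewrite [leRHS](splitr d) lerD2l ltW.
have lim : ((fun h : C^o =>
    (h^-1 *: ((F \o shift (z : C^o)) (h *: (1 : C^o)) - F z))%R : C^o) @ 0^' --> (F2 : C^o))%classic.
  (* B may be 0, so B + 1 serves as the divisor of eps. *)
  have B1 : 0 < B + 1 by rewrite ltr_wpDl.
  apply/cvgrPdist_lt => eps e0; near=> k.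
  have k0 : k != 0 by near: k; exact: nbhs_dnbhs_neq.
  have [|J FE JB] := taylor k.
    by near: k; apply: dnbhs0_lt; rewrite divr_gt0.
  have -> : F2 - k^-1 *: ((F \o shift (z : C^o)) (k *: (1 : C^o)) - F z) = - (k * J).
    rewrite /= /shift /= /GRing.scale /= mulr1 FE; field; exact: k0.
  rewrite normrN normrM (@le_lt_trans _ _ (`|k| * B)) ?ler_wpM2l //.
  rewrite (@le_lt_trans _ _ (`|k| * (B + 1))) ?ler_wpM2l ?lerDl //.
  rewrite -ltr_pdivlMr //.
  by near: k; apply: dnbhs0_lt; exact: divr_gt0 e0 B1.
split; first by apply/cvg_ex; exists F2.
exact: cvg_lim lim.
Unshelve. all: by end_near. Qed.

(** A common form for both families: G_n is the case p = Phi_n and G_(n-1)^* the case p =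
    Phi_(n-1)^*, with the same exponent n. *)
Definition cauchy_transform p (n : nat) (z : C) : C :=
  (2 * pi%:C * 'i)^-1 *
  circle_integral (fun t => p.[t] / (t - z) * (nu_bessel l t / t ^+ n)).

Local Notation K := cauchy_transform.
Local Notation M := (moment bessel_moment).
Local Notation i2pi := ((2 * pi%:C * 'i)^-1 : C).

Lemma cauchy_transformE p n z : K p n z = i2pi * I (fun t => weighted_path p n t / (e t - z)).
Proof.
rewrite /cauchy_transform circle_integralE; congr (_ * _); congr cRintegral; apply/funext => t.
by rewrite nu_bessel_circle /weighted_path; ring.
Qed.

Lemma cauchy_transformD p q n z : `|z| != 1 -> K (p + q) n z = K p n z + K q n z.
Proof.
move=> z1; rewrite !cauchy_transformE -mulrDr -cRintegralD.
- by congr (_ * _); congr cRintegral; apply/funext => t; rewrite /weighted_path hornerD; ring.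
- exact/(path_smooth_div_circle z1)/weighted_path_smooth.
- exact/(path_smooth_div_circle z1)/weighted_path_smooth.
Qed.

Lemma cauchy_transformZ a p n z : `|z| != 1 -> K (a *: p) n z = a * K p n z.
Proof.
move=> z1; rewrite !cauchy_transformE mulrCA -(@cRintegralZ _ _ _ a).
  by congr (_ * _); congr cRintegral; apply/funext => t; rewrite /weighted_path hornerZ; ring.
exact/(path_smooth_div_circle z1)/weighted_path_smooth.
Qed.

Lemma cauchy_transformB p q n z : `|z| != 1 -> K (p - q) n z = K p n z - K q n z.
Proof.
by move=> z1; rewrite -scaleN1r cauchy_transformD // cauchy_transformZ // mulN1r.
Qed.

(** From t/(t-z) = z/(t-z) + 1, the summand 1 contributing a moment. *)
Lemma cauchy_transformMX p n z : `|z| != 1 ->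
  K ('X * p) n z = z * K p n z + (2 * pi%:C)^-1 * M (n%:Z - 1) p.
Proof.
move=> z1; rewrite !cauchy_transformE.
have s1 := path_smooth_div_circle z1 (weighted_path_smooth p n).
have -> : (2 * pi%:C)^-1 * M (n%:Z - 1) p = i2pi * I (weighted_path p n).
  rewrite cRintegral_weighted_path [in RHS]invfM -!mulrA; congr (_ * _).
  by rewrite mulKf // neq0Ci.
rewrite mulrCA -mulrDr -(@cRintegralZ _ _ _ z) // -cRintegralD.
- congr (_ * _); congr cRintegral; apply/funext => t; rewrite /weighted_path hornerM hornerX.
  by field; rewrite expf_neq0 ?circle_neq0 // sub_circle_neq0.
- by apply: path_smoothM => //; exact: path_smooth_cst.
- exact: weighted_path_smooth.
Qed.

Lemma cauchy_transform_shift p n z : K ('X * p) n.+1 z = K p n z.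
Proof.
rewrite !cauchy_transformE; congr (_ * _); congr cRintegral; apply/funext => t.
rewrite /weighted_path hornerM hornerX exprS invfM.
have /divff E := circle_neq0 t.
transitivity ((e t / e t) * (p.[e t] * (w t / e t ^+ n) * ('i%R * e t) / (e t - z))); first by ring.
by rewrite E mul1r.
Qed.

(* weight_deriv p n * nu * t^(-n-2) is the derivative of p * nu * t^(-n). *)
Definition weight_deriv p (n : nat) : {poly C} :=
  'X * ('X * p^`()) - n%:R *: ('X * p) + L *: ('X * ('X * p)) - L *: p.

(** Up to a factor i this is the contour integral of the derivative of p nu z^(-n); it is computed
    here from the Pearson recursion. *)
Lemma moment_weight_deriv p n : M n.+1%:Z (weight_deriv p n) = 0.
Proof.
have E1 : n.+1%:Z - 1 = n%:Z by lia.
have E2 : n%:Z + 1 = n.+1%:Z by lia.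
rewrite /weight_deriv momentB momentD momentB !momentZ momentMX E1.
rewrite (moment_deriv _ _ bessel_pearson) !momentMX E1 E2 -pmulrn; ring.
Qed.

(** The difference of the two integrands is, up to sign, the t-derivative of p nu z^(-n) / (e t -
    z), a function taking the same value at 0 and 2 pi. *)
Lemma cRintegral_by_parts p n z : `|z| != 1 ->
  I (fun t => weighted_path p n t / (e t - z) / (e t - z)) =
  I (fun t => weighted_path (weight_deriv p n) n.+2 t / (e t - z)).
Proof.
move=> z1.
have s1 := path_smooth_div_circle z1 (weighted_path_smooth p n).
have s2 := path_smooth_div_circle z1 s1.
have s3 := path_smooth_div_circle z1 (weighted_path_smooth (weight_deriv p n) n.+2).
have D1 := path_derivM path_deriv_weight (path_deriv_circleX (- n%:Z)).
have D2 := path_derivM (path_deriv_horner p path_deriv_circle) D1.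
have D3 := path_derivV (sub_circle_neq0 z1) (path_derivD path_deriv_circle (path_deriv_cst (- z))).
have := path_derivM D2 D3.
set g := (fun t => _ * _); set dg := (fun t => _ * _ + _) => D.
have dgE : dg = (fun t => weighted_path (weight_deriv p n) n.+2 t / (e t - z) +
   -1 * (weighted_path p n t / (e t - z) / (e t - z))).
  apply/funext => t; rewrite /dg /weighted_path /weight_deriv.
  rewrite !(hornerD, hornerN, hornerZ, hornerM, hornerX) -exprnN mulrNz -pmulrn.
  rewrite !exprS.
  field.
  by rewrite expf_neq0 ?circle_neq0 // sub_circle_neq0.
have s4 : path_smooth (fun t => -1 * (weighted_path p n t / (e t - z) / (e t - z))).
  by apply: path_smoothM => //; exact: path_smooth_cst.
rewrite dgE in D; have := cRintegral_deriv twopi_gt0 D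
  (path_smoothD s3 s4).
have -> : g twopi = g 0.
  have E1 : cos twopi = cos 0 :> R by rewrite mulr_natl cos2pi cos0.
  have E2 : sin twopi = sin 0 :> R by rewrite mulr_natl sin2pi sin0.
  by rewrite /g E1 E2.
by rewrite cRintegralD // cRintegralZ // mulN1r !subrr => /eqP; rewrite subr_eq0 => /eqP.
Qed.

(** By parts, the derivative is [K q n.+2 z]. Writing [K q n] as [K ('X * ('X * q)) n.+2] and
    extracting the two factors X gives z^2 times this derivative plus the moments of q of index n +
    1, which is 0, and n. *)
Lemma cauchy_transform_ode p n z : `|z| != 1 ->
  derivable (K p n : C^o -> C^o) z 1 /\
  z ^+ 2 * derive1 (K p n : C -> C^o) z =
    K (weight_deriv p n) n z - (2 * pi%:C)^-1 * M n%:Z (weight_deriv p n).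
Proof.
move=> z1; set q := weight_deriv p n.
have KE : (K p n : C^o -> C^o) = i2pi \*:
    (fun z : C^o => I (fun t => weighted_path p n t / (e t - z)) : C^o).
  by apply/funext => x; rewrite cauchy_transformE.
have H : is_derive (z : C^o) (1 : C^o) (K p n : C^o -> C^o) (K q n.+2 z).
  rewrite KE cauchy_transformE -(cRintegral_by_parts _ _ z1).
  have D := cauchy_transform_derive z1 (weighted_path_smooth p n).
  exact: (@is_deriveZ _ _ _ _ i2pi _ _ _ D).
split; first by case: H.
rewrite derive1E; have -> : 'D_1 (K p n : C^o -> C^o) z = K q n.+2 z by case: H.
rewrite -(cauchy_transform_shift q n) -(cauchy_transform_shift _ n.+1).
rewrite !cauchy_transformMX // momentMX.
have -> : n.+2%:Z - 1 = n.+1%:Z by lia.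
have -> : n.+1%:Z - 1 = n%:Z by lia.
rewrite moment_weight_deriv; ring.
Qed.

End Circle.

(** * From the orthogonality relations to the moment hypotheses *)

Section BesselOPUC.
Context {R : realType}.
Local Notation C := R[i].
Variables (l : R) (Phi : nat -> {poly C}) (kappa : nat -> R).
Hypothesis l_gt0 : 0 < l.
Hypothesis PhiP : monic_OPUC (nu_bessel l) Phi kappa.

Local Notation L := (l%:C / 2 : C).
Local Notation M := (moment (bessel_moment l)).
Let h n : C := (kappa n ^- 2)%:C.
Let Phis n := star_poly n (Phi n).
Let a n : C := - (Phi n)`_0.

(** On the circle d mu = nu dt and conj(z) = 1/z, so expanding q gives moments of p. *)
Lemma mu_integral_moment (p q : {poly C}) :
  mu_integral (nu_bessel l) (fun z => p.[z] * (q.[z])^*) =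
  \sum_(j < size q) conjc q`_j * M j%:Z p.
Proof.
rewrite /mu_integral circle_integralE.
pose F (j : 'I_(size q)) t : C :=
  p.[cos t +i* sin t] * (cos t +i* sin t) ^ (- j%:Z) * (expR (l * cos t))%:C.
have sF j : path_smooth (F j).
  apply: path_smoothM; last exact: path_smooth_weight.
  by apply: path_smoothM; [exact/path_smooth_horner/path_smooth_circle|exact: path_smooth_circleX].
under eq_bigr do rewrite -momentE.
rewrite -(cRintegral_sum 0 (2 * pi) (fun j => conjc q`_j) sF); congr cRintegral; apply/funext => t.
rewrite nu_bessel_circle -mulrA mulrVK; last first.
  by rewrite unitfE mulf_neq0 ?neq0Ci ?circle_neq0.
rewrite [q.[_]]horner_coef rmorph_sum mulr_sumr mulr_suml; apply: eq_bigr => j _.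
rewrite /F rmorphM rmorphXn -exprnN -exprVn -circle_conj; ring.
Qed.

Let Phi_monic n : Phi n \is monic. Proof. by case: PhiP. Qed.
Let size_Phi n : size (Phi n) = n.+1. Proof. by case: PhiP. Qed.
Let kappa_gt0 n : 0 < kappa n. Proof. by case: PhiP. Qed.

Lemma OPUC_h_neq0 n : h n != 0.
Proof. by rewrite -[0]/(0%:C) (inj_eq (@complexI R)) invr_eq0 expf_neq0 // gt_eqF. Qed.

Lemma half_l_neq0 : L != 0.
Proof.
by rewrite mulf_neq0 ?invr_eq0 ?pnatr_eq0 // -[0]/(0%:C) (inj_eq (@complexI R)) gt_eqF.
Qed.

Lemma half_l_conj : conjc L = L.
Proof. by rewrite rmorphM fmorphV rmorph_nat /= oppr0. Qed.

Lemma OPUC_orth n m : \sum_(j < m.+1) conjc (Phi m)`_j * M j%:Z (Phi n) = if n == m then h n else 0.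
Proof.
by case: PhiP => _ _ _ /(_ n m); rewrite mu_integral_moment size_Phi.
Qed.

(** Since [Phi m] is monic, orthogonality to it is a triangular relation: once the lower moments
    vanish, only the m-th remains. Strong induction on m then yields all moments up to index n. *)
Lemma OPUC_moment_lead n m : (forall j, (j < m)%N -> M j%:Z (Phi n) = 0) ->
  M m%:Z (Phi n) = if n == m then h n else 0.
Proof.
move=> H; rewrite -OPUC_orth big_ord_recr /= big1 ?add0r; last by move=> j _; rewrite H // mulr0.
have := Phi_monic m; rewrite monicE lead_coefE size_Phi => /eqP ->.
by rewrite conjc1 mul1r.
Qed.

Lemma OPUC_moment_lt n j : (j < n)%N -> M j%:Z (Phi n) = 0.
Proof.
elim/ltn_ind: j => j IH jn; rewrite OPUC_moment_lead ?gtn_eqF //.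
by move=> i ij; rewrite IH // (ltn_trans ij).
Qed.

Lemma OPUC_moment_eq n : M n%:Z (Phi n) = h n.
Proof. by rewrite OPUC_moment_lead ?eqxx // => j; exact: OPUC_moment_lt. Qed.

Let pearson := bessel_pearson l.
Let cN := bessel_momentN l.

Lemma verblunsky_succ m : verblunsky Phi m%:Z = a m.+1.
Proof.
rewrite /verblunsky horner_coef0 /a; congr (- _).
exact: (Phi_coef_real half_l_neq0 half_l_conj cN pearson Phi_monic size_Phi
  OPUC_h_neq0 OPUC_moment_lt OPUC_moment_eq).
Qed.

(** For m = 0 the convention alpha_(-1) = -1 agrees with -Phi_0(0). *)
Lemma verblunsky_sub2 m : verblunsky Phi (m.+1%:Z - 2) = a m.
Proof.
case: m => [|m]; first by rewrite /a (alphaN1 Phi_monic size_Phi).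
by rewrite -verblunsky_succ; congr verblunsky; lia.
Qed.

Lemma bcoef_ratio m : bcoef kappa m * (bcoef kappa m.+1)^-1 = h m.+1 / h m.
Proof.
have k0 := kappa_gt0 m; have k1 := kappa_gt0 m.+1.
rewrite /bcoef /h; move: (pi_gt0 R); move: (@pi R) => c c0.
rewrite -!fmorphV -!rmorphM; congr (_%:C); field.
by rewrite (gt_eqF k0) (gt_eqF k1) (gt_eqF c0).
Qed.

End BesselOPUC.

(** * The four differential identities for the Bessel weight *)

Theorem mainTheorem8 (R : realType) (l : R) (Phi : nat -> {poly R[i]})
    (kappa : nat -> R) (hl : 0 < l)
    (hPhi : monic_OPUC (nu_bessel l) Phi kappa) :
  let L : R[i] := l%:C / 2 in
  let alpha := verblunsky Phi in
  let b := bcoef kappa in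
  let G := Gfun (nu_bessel l) Phi in
  let Gs := Gstar (nu_bessel l) Phi in
  let Phis := fun k => star_poly k (Phi k) in
  (forall k : int, alpha k \is Num.real) /\
  forall n : nat, (0 < n)%N ->
  [/\ forall z : R[i],
        z ^+ 2 * ((Phi n)^`()%R).[z] =
          (n%:R * z + L - L * alpha (n%:Z - 1) ^+ 2) * (Phi n).[z]
          + L * b n.-1 * (b n)^-1 * (alpha (n%:Z - 1) - alpha n%:Z * z)
            * (Phis n.-1).[z],
      forall z : R[i], `|z| != 1 ->
        derivable (G n : R[i]^o -> R[i]^o) z 1 /\
        z ^+ 2 * (derive1 (G n : R[i] -> R[i]^o) z) =
          (L * z ^+ 2 - L * alpha (n%:Z - 1) ^+ 2) * G n z
          + L * b n.-1 * (b n)^-1 * (alpha (n%:Z - 1) - alpha n%:Z * z)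
            * Gs n.-1 z,
      forall z : R[i],
        z ^+ 2 * ((Phis n.-1)^`()%R).[z] =
          L * (alpha (n%:Z - 1) - alpha (n%:Z - 2) * z) * (Phi n).[z]
          + (- L * z ^+ 2 + L * alpha (n%:Z - 1) ^+ 2) * (Phis n.-1).[z] &
      forall z : R[i], `|z| != 1 ->
        derivable (Gs n.-1 : R[i]^o -> R[i]^o) z 1 /\
        z ^+ 2 * (derive1 (Gs n.-1 : R[i] -> R[i]^o) z) =
          L * (alpha (n%:Z - 1) - alpha (n%:Z - 2) * z) * G n z
          + (- n%:R * z - L + L * alpha (n%:Z - 1) ^+ 2) * Gs n.-1 z].
Proof.
move=> L alpha b G Gs Phis.
have PhiM n : Phi n \is monic by case: hPhi.
have sPhi n : size (Phi n) = n.+1 by case: hPhi.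
have L0 := half_l_neq0 hl; have Lr := half_l_conj l.
have h0 := OPUC_h_neq0 hPhi; have Mlt := OPUC_moment_lt hPhi; have Meq := OPUC_moment_eq hPhi.
have cN := bessel_momentN l; have pe := bessel_pearson l.
have ar n := alpha_real L0 Lr cN pe PhiM sPhi h0 Mlt Meq n.
have alphaS m : verblunsky Phi m%:Z = - (Phi m.+1)`_0 := verblunsky_succ hl hPhi m.
have alphaB m : verblunsky Phi (m.+1%:Z - 2) = - (Phi m)`_0 := verblunsky_sub2 hl hPhi m.
split.
  have cr (x : R[i]) : conjc x = x -> x \is Num.real by move=> E; apply/CrealP.
  case=> m; first by apply: cr; rewrite /alpha alphaS ar.
  by rewrite /alpha /= realN real1.
case=> // n _; have nE : n.+1%:Z - 1 = n%:Z by lia.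
rewrite nE.
rewrite /alpha alphaB !alphaS /=.
have EPhi := Phi_deriv_eq L0 Lr cN pe PhiM sPhi h0 Mlt Meq n.
have EPhis := Phis_deriv_eq L0 Lr cN pe PhiM sPhi h0 Mlt Meq n.
have Mn := moment_Phi_succ L0 Lr cN pe PhiM sPhi h0 Mlt Meq (leqnn n).
have rE := rhoE L0 Lr cN pe PhiM sPhi h0 Mlt Meq n.
rewrite -!(mulrA L (b n)) (bcoef_ratio hPhi).
move: EPhi EPhis Mn rE.
rewrite -/L -/(Phis n); set rho := (_ ^- 2)%:C / _;
set a1 := - (Phi n.+1)`_0; set a2 := - (Phi n.+2)`_0; set a0 := - (Phi n)`_0.
move=> EPhi EPhis Mn rE.
have Mlt0 : moment (bessel_moment l) (n.+1%:Z - 1) (Phi n.+1) = 0.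
  by rewrite -[RHS](Mlt n.+1 n (ltnSn n)); congr moment; lia.
(* The terms (n+1) X Phi and L Phi of the identity cancel against those of [weight_deriv]. *)
have qPhi : weight_deriv l (Phi n.+1) n.+1 =
    L *: ('X * ('X * Phi n.+1)) - (L * a1 ^+ 2) *: Phi n.+1
    + (L * rho * a1) *: Phis n - (L * rho * a2) *: ('X * Phis n).
  by rewrite /weight_deriv EPhi -/L -!mul_polyC !(rmorphB, rmorphM) /=; ring.
(* Here the term -L X^2 Phis of the identity cancels. The exponent is n + 1 although the polynomial
   has index n, as in the definition of [Gstar]. *)
have qPhis : weight_deriv l (Phis n) n.+1 =
    (L * a1) *: Phi n.+1 - (L * a0) *: ('X * Phi n.+1)
    + (L * a1 ^+ 2 - L) *: Phis n - n.+1%:R *: ('X * Phis n).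
  by rewrite /weight_deriv EPhis -/L -!mul_polyC !(rmorphB, rmorphM) /=; ring.
split.
- move=> z; have := congr1 (horner^~ z) EPhi.
  rewrite !(hornerD, hornerN, hornerZ, hornerM, hornerX) mulrA -expr2 => ->.
  ring.
- move=> z zT; have [D ->] := cauchy_transform_ode l (Phi n.+1) n.+1 zT.
  split=> //.
  have -> : G n.+1 z = cauchy_transform l (Phi n.+1) n.+1 z by [].
  have -> : Gs n z = cauchy_transform l (Phis n) n.+1 z by [].
  rewrite qPhi !(momentB, momentD, momentZ) !momentMX.
  rewrite !(cauchy_transformB, cauchy_transformD, cauchy_transformZ, cauchy_transformMX) //.
  rewrite Mlt0 !momentMX; move: (2 * pi%:C)^-1 => c.
  (* The moments produced by the factors X cancel between the two terms of [cauchy_transform_ode],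
     except for the moment of index n of [Phi n.+1], which is 0. The surplus is this expression,
     which vanishes by [moment_Phi_succ] at j = n. *)
  have E : c * L * a1 * (a1 * moment (bessel_moment l) n.+1%:Z (Phi n.+1)
      - rho * moment (bessel_moment l) n.+1%:Z (Phis n)) = 0.
    by rewrite Mn subrr mulr0.
  rewrite -[RHS]addr0 -[X in _ = _ + X]E; ring.
- move=> z; have := congr1 (horner^~ z) EPhis.
  rewrite !(hornerD, hornerN, hornerZ, hornerM, hornerX) mulrA -expr2 => ->.
  ring.
- move=> z zT; have [D ->] := cauchy_transform_ode l (Phis n) n.+1 zT.
  split=> //.
  have -> : G n.+1 z = cauchy_transform l (Phi n.+1) n.+1 z by [].
  have -> : Gs n z = cauchy_transform l (Phis n) n.+1 z by [].
  rewrite qPhis !(momentB, momentD, momentZ) !momentMX.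
  rewrite !(cauchy_transformB, cauchy_transformD, cauchy_transformZ, cauchy_transformMX) //.
  rewrite Mlt0; move: (2 * pi%:C)^-1 => c.
  (* The surplus moments again form the relation of [moment_Phi_succ] at j = n, with rho written as
     1 - a1^2. *)
  have E : - c * L * (a1 * moment (bessel_moment l) n.+1%:Z (Phi n.+1)
      - (1 - a1 ^+ 2) * moment (bessel_moment l) n.+1%:Z (Phis n)) = 0.
    by rewrite Mn -rE subrr mulr0.
  rewrite -[RHS]addr0 -[X in _ = _ + X]E; ring.
Qed.
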